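(* Let $V$ be a finite-dimensional $\Bbbk$-vector space, let $W \subseteq S^dV$ be a linear series (linear subspace) of forms of degree $d$, and let $0\le a<d$. If $W$ is concise, then $$ r(W) \geq \operatorname{rank} C^{(0,d-a)}_W + \dim\widehat{\Sigma}_{(1,a)}(W) . $$
   Context: $\Bbbk$ is an algebraically closed field of characteristic $0$. $S^dV$ is the space of homogeneous polynomials of degree $d$ in a basis $x_1,\dots,x_n$ of $V$; $S^bV^*$ is identified with the space of homogeneous constant-coefficient differential operators of order $b$ (polynomials of degree $b$ in $\partial_i=\partial/\partial x_i$). The simultaneous Waring rank $r(W)$ is the least $r$ such that there are linear forms $\ell_1,\dots,\ell_r\in V$ with $W\subseteq \operatorname{span}\{\ell_1^d,\dots,\ell_r^d\}$. $W$ is concise (with respect to $V$) if whenever $W\subseteq S^dV'$ for a linear subspace $V'\subseteq V$, one has $V'=V$. The catalecticant $C^{(0,b)}_W : S^bV^* \to \operatorname{Hom}(W,S^{d-b}V)$ is the linear map $D\mapsto (F\mapsto DF)$. $\widehat{\Sigma}_{(1,a)}(W)\subseteq V^*$ is the affine cone consisting of the common zeros in $V^*$ of all the partial derivatives of order $a$ of all members of $W$, i.e. of all $DF\in S^{d-a}V$ with $D\in S^aV^*$, $F\in W$ (equivalently, the origin together with the points at which every member of $W$ vanishes to order at least $a+1$). It always contains the origin. *)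

(* Defs.v *)
From HB Require Import structures.
From mathcomp Require Import all_boot all_order all_algebra.
From mathcomp Require Import boolp classical_sets.
From mathcomp Require Import ssrcomplements mpoly.

Set Implicit Arguments.
Unset Strict Implicit.
Unset Printing Implicit Defensive.

Import Order.TTheory GRing.Theory.
Local Open Scope ring_scope.

(* [hform k n d] is S^d V for V with basis 'X_0, ..., 'X_(n-1); it also serves
   as S^d V^*, reading 'X_i as the derivation d/d'X_i.  It is an alias of
   [dhomog n k d], because the library provides the finite-dimensional
   structure of [dhomog] only when the number of variables is a successor,
   whereas V = 0 is allowed here.  Note that 'C((d + n).-1, d) is 0 or 1 when
   n = 0, according to whether d > 0 or d = 0. *)
Definition hform (k : fieldType) (n d : nat) : Type := dhomog n k d.

HB.instance Definition _ (k : fieldType) (n d : nat) :=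
  GRing.Lmodule.copy (hform k n d) (dhomog n k d).
HB.instance Definition _ (k : fieldType) (n d : nat) :=
  SubType.copy (hform k n d) (dhomog n k d).

Lemma hform_vecaxiom (k : fieldType) (n d : nat) :
  Vector.axiom 'C((d + n).-1, d) (hform k n d).
Proof.
case: n => [|n]; last by rewrite addnS; exact: dhomog_vecaxiom.
have m0 (m : 'X_{1..0}) : m = 0%MM by apply/mnmP; case.
case: d => [|d].
  exists (fun p : hform k 0 0 => \row_(_ < 1) (val p)@_0%MM) => [c p q|].
    by apply/rowP => i; rewrite !mxE /= mcoeffD mcoeffZ.
  have h (r : 'rV[k]_1) : (r 0 0)%:MP_[0] \is 0.-homog.
    by rewrite -[_%:MP]mulr1 mul_mpolyC; exact/rpredZ/dhomog1.
  exists (fun r => DHomog (h r)) => [p|r].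
    by apply/val_inj/mpolyP => m /=; rewrite (m0 m) mcoeffC eqxx mulr1 mxE.
  by apply/rowP => i; rewrite mxE /= mcoeffC eqxx mulr1 ord1.
rewrite bin_small ?addn0 //.
exists (fun _ : hform k 0 d.+1 => 0) => [c p q|].
  by rewrite scaler0 addr0.
exists (fun _ => 0) => [p|r]; last by apply/rowP; case.
apply/val_inj/mpolyP => m /=; rewrite mcoeff0 (m0 m).
apply/esym/(@dhomog_nemf_coeff _ _ mdeg d.+1); first exact: dhomog_is_dhomog.
by rewrite mf0.
Qed.

HB.instance Definition _ (k : fieldType) (n d : nat) :=
  Lmodule_hasFinDim.Build k (hform k n d) (@hform_vecaxiom k n d).

Definition diffop (k : fieldType) (n : nat) (D F : {mpoly k[n]}) :
    {mpoly k[n]} :=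
  \sum_(m <- msupp D) D@_m *: F^`M[m].

Lemma diffopwE (k : fieldType) (n w : nat) (D F : {mpoly k[n]}) :
  (msize D <= w)%N -> diffop D F = \sum_(m : 'X_{1..n < w}) D@_m *: F^`M[m].
Proof.
move=> le_Dw.
rewrite /diffop (big_mksub 'X_{1..n < w}) /=; first last.
- by move=> m mD; apply: leq_trans (msize_mdeg_lt mD) le_Dw.
- exact: msupp_uniq.
rewrite [RHS](bigID (fun m : 'X_{1..n < w} => val m \in msupp D)) /=.
rewrite [X in _ + X]big1 ?addr0 // => m mD.
by rewrite memN_msupp_eq0 ?scale0r.
Qed.

Lemma diffop_linearl (k : fieldType) (n : nat) (F : {mpoly k[n]}) :
  linear (fun D => diffop D F).
Proof.
move=> c D E.
pose w := maxn (msize (c *: D + E)) (maxn (msize D) (msize E)).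
rewrite !(@diffopwE k n w) ?leq_max ?leqnn ?orbT // scaler_sumr -big_split /=.
by apply: eq_bigr => m _; rewrite mcoeffD mcoeffZ scalerDl scalerA.
Qed.

Lemma diffop_linearr (k : fieldType) (n : nat) (D : {mpoly k[n]}) :
  linear (diffop D).
Proof.
move=> c F G; rewrite /diffop scaler_sumr -big_split /=.
apply: eq_bigr => m _.
by rewrite mderivmD mderivmZ scalerDr !scalerA mulrC.
Qed.

Lemma diffop_homog (k : fieldType) (n b d : nat) (D : hform k n b)
    (F : hform k n d) :
  diffop (val D) (val F) \is (d - b).-homog.
Proof.
rewrite /diffop big_seq rpred_sum // => m mD; apply: rpredZ.
have dm : mdeg m = b by move/dhomogP: (dhomog_is_dhomog D); apply.
apply/dhomogP => m' ; rewrite mcoeff_msupp mcoeff_mderivm.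
apply: contraNeq => ne; rewrite (@dhomog_nemf_coeff _ _ mdeg d) ?mul0rn //.
  exact: dhomog_is_dhomog.
by apply: contraNneq ne => <-; rewrite mfD /= dm addKn.
Qed.

Section LinearSeries.
Variables (k : fieldType) (n d : nat).
Implicit Types (W : {vspace hform k n d}) (F : hform k n d).

Definition dact b (D : hform k n b) F : hform k n (d - b) :=
  DHomog (diffop_homog D F).

Definition catalecticant W b :
    'Hom(hform k n b, 'Hom(subvs_of W, hform k n (d - b))) :=
  linfun (fun D => linfun (fun F : subvs_of W => dact D (vsval F))).

Lemma catalecticantE W b (D : hform k n b) (F : subvs_of W) :
  catalecticant W b D F = dact D (vsval F).
Proof.
have linF (E : hform k n b) : linear (fun G : subvs_of W => dact E (vsval G)).
  by move=> c G H; apply: val_inj; rewrite linearP; exact: diffop_linearr.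
have evF (E : hform k n b) (G : subvs_of W) :
    linfun (fun G : subvs_of W => dact E (vsval G)) G = dact E (vsval G).
  pose L := GRing.isLinear.Build _ _ _ _ _ (linF E).
  pose f : {linear subvs_of W -> hform k n (d - b)} :=
    HB.pack (fun G : subvs_of W => dact E (vsval G)) L.
  exact: (lfunE f G).
pose g (E : hform k n b) := linfun (fun G : subvs_of W => dact E (vsval G)).
have linD : linear g.
  move=> c E E'; apply/lfunP => G; rewrite add_lfunE scale_lfunE !evF.
  by apply: val_inj; exact: diffop_linearl.
pose L := GRing.isLinear.Build _ _ _ _ _ linD.
pose f : {linear hform k n b -> 'Hom(subvs_of W, hform k n (d - b))} :=
  HB.pack g L.
by rewrite -evF -/(g D); congr (fun_of_lfun _ F); exact: (lfunE f D).
Qed.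

(* F lies in S^d V', i.e. F is a homogeneous polynomial of degree d in a basis
   of V'. *)
Definition in_sympow (V' : {vspace hform k n 1}) F : Prop :=
  exists2 G : {mpoly k[\dim V']},
    G \is d.-homog & val F = G \mPo map_tuple val (vbasis V').

Definition concise W : Prop :=
  forall V' : {vspace hform k n 1},
    (forall F, F \in W -> in_sympow V' F) -> V' = fullv.

Lemma hformX_homog (l : hform k n 1) : val l ^+ d \is d.-homog.
Proof.
by have := dhomogMn d (dhomog_is_dhomog l); rewrite mul1n.
Qed.

Definition hformX (l : hform k n 1) : hform k n d := DHomog (hformX_homog l).

(* On nat, the infimum of a nonempty set is its least element. *)
Definition waring_rank W : nat :=
  infimum 0%N
    [set r | exists l : r.-tuple (hform k n 1), (W <= <<map hformX l>>)%VS].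

(* Points of V^* are given by their coordinates in the basis dual to the
   variables. *)
Definition Sigma W (a : nat) : set ('I_n -> k) :=
  [set v | forall (D : hform k n a) F, F \in W -> (val (dact D F)).@[v] = 0].

End LinearSeries.

Section ZariskiDimension.
Variables (k : fieldType) (n : nat).
Local Open Scope classical_set_scope.
Implicit Types X Z A B : set ('I_n -> k).

Definition zariski_closed Z : Prop :=
  exists S : set {mpoly k[n]}, Z = [set v | forall p, S p -> p.@[v] = 0].

Definition irreducible_closed Z : Prop :=
  [/\ zariski_closed Z, Z !=set0 &
    forall A B, zariski_closed A -> zariski_closed B ->
      Z `<=` A `|` B -> Z `<=` A \/ Z `<=` B].

Definition irreducible_chain X (e : nat) : Prop :=
  exists Z : nat -> set ('I_n -> k),
    [/\ forall i, (i <= e)%N -> irreducible_closed (Z i),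
        forall i, (i < e)%N -> Z i `<` Z i.+1
      & Z e `<=` X].

(* The Krull dimension of a Zariski closed set.  The supremum exists, as the
   lengths of such chains are at most n. *)
Definition zariski_dim X : nat := supremum 0%N [set e | irreducible_chain X e].

End ZariskiDimension.

(* Main.v *)
From HB Require Import structures.
Require Import Defs.
From mathcomp Require Import all_boot all_order all_algebra.
From mathcomp Require Import boolp classical_sets.
From mathcomp Require Import ssrcomplements mpoly ring.

(** Write b = d - a and let l_1, ..., l_r be linear forms whose d-th powers
    span a space containing W; such forms exist because, in characteristic 0,
    every form is a combination of powers of linear forms
    ([exists_waring_decomposition]).  Write F = \sum_i w_i(F) l_i^d for F in W.

    A derivation D of order b sends l_i^d to a multiple of D(l_i) l_i^a, the
    same multiple for all i.  So the catalecticant factors through the linear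
    map on k^r which sends u to (F |-> \sum_i u_i w_i(F) l_i^a), and the kernel
    K of that map has dimension c with c + rank C <= r.  If v lies in Sigma, all
    order a derivatives of F vanish at v, that is
    \sum_i w_i(F) D(l_i) l_i(v)^b = 0 for every D of order a: the form
    \sum_i l_i(v)^b w_i(F) l_i^a is killed by all derivations of its own order,
    hence it is zero.  So the point (l_i(v)^b)_i of k^r is in K, and on Sigma
    the r functions l_i^b are combinations of only c functions y_1, ..., y_c
    ([Sigma_powers_span]).

    It remains to see that dim Sigma <= c.  By conciseness the l_i span V, so
    the l_i generate the coordinate ring; their b-th powers are combinations of
    the y_j, which makes the ring a finite extension of its subring generated
    by c elements.  Dimension theory is replaced by counting dimensions of
    spaces of functions.  On the one hand, the polynomials of degree at most t
    restricted to Sigma lie in the span of the b^r (t+1)^c products l^rho y^mu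
    with all rho_i < b and all mu_j <= t ([spanned_mpoly]).  On the other hand,
    a chain of irreducible closed sets of length e provides, for some w and
    every s, at least 'C(s + e, e) polynomials of degree at most w s that are
    linearly independent on the top of the chain ([chain_indep]).  As s grows,
    this forces e <= c ([binomial_growth]). *)

Set Implicit Arguments.
Unset Strict Implicit.
Unset Printing Implicit Defensive.

Import Order.TTheory GRing.Theory.
Local Open Scope ring_scope.

(** * Derivatives of powers of linear forms *)

Lemma mnm_ind n (P : 'X_{1..n} -> Prop) :
  P 0%MM -> (forall i m, P m -> P (m + U_(i))%MM) -> forall m, P m.
Proof.
move=> P0 PS m; have [e] := ubnP (mdeg m); elim: e m => // e IH m ltme.
have [->|nz] := eqVneq m 0%MM; first exact: P0.
have [i mi] : exists i, m i != 0%N.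
  apply/existsP; apply: contraNT nz => /existsPn m0.
  by apply/eqP/mnmP => i; rewrite mnm0E; apply/eqP; move: (m0 i); rewrite negbK.
have mE : m = (m - U_(i) + U_(i))%MM by rewrite submK // lep1mP.
rewrite mE; apply: PS; apply: IH.
by move: ltme; rewrite [in X in X -> _]mE mdegD mdeg1 addn1.
Qed.

Section LinearForms.
Variables (k : fieldType) (n : nat).
Implicit Types (c : 'I_n -> k) (D : {mpoly k[n]}) (m : 'X_{1..n}).

Definition linform c : {mpoly k[n]} := \sum_i c i *: 'X_i.

Lemma linform_homog c : linform c \is 1.-homog.
Proof.
by apply: rpred_sum => i _; apply: rpredZ; rewrite dhomogX /= mdeg1.
Qed.

Lemma hform1E (l : hform k n 1) :
  val l = linform (fun i => (val l)@_U_(i)).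
Proof.
apply/mpolyP => m; rewrite /linform raddf_sum /=.
under eq_bigr do rewrite mcoeffZ mcoeffX.
have [/mdeg1P[i /eqP ->]|m1] := boolP (mdeg m == 1%N).
  rewrite (bigD1 i) //= eqxx mulr1 big1 ?addr0 // => j ji.
  by rewrite eq_mnm1 (negPf ji) mulr0.
rewrite (dhomog_nemf_coeff (dhomog_is_dhomog l)) // big1 // => j _.
by case: (U_(j)%MM =P m) m1 => [<-|_ _]; rewrite ?mdeg1 // mulr0.
Qed.

Lemma mderiv_linform i c : (linform c)^`M(i) = (c i)%:MP.
Proof.
rewrite /linform raddf_sum /= (bigD1 i) //= big1 ?addr0 => [|j ji].
  have UU0 : (U_(i) - U_(i) = 0 :> 'X_{1..n})%MM.
    by apply/mnmP => j; rewrite mnmBE subnn mnm0E.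
  by rewrite mderivZ mderivX mnm1E eqxx scale1r UU0 mpolyX0 -mul_mpolyC mulr1.
by rewrite mderivZ mderivX mnm1E (negPf ji) scale0r scaler0.
Qed.

Lemma mderiv_linformX i c e :
  (linform c ^+ e)^`M(i) = (c i * e%:R) *: linform c ^+ e.-1.
Proof.
elim: e => [|e IH]; first by rewrite expr0 -mpolyC1 mderivC mulr0 scale0r.
rewrite exprS mderivM IH mderiv_linform mul_mpolyC /= -scalerAr.
case: e {IH} => [|e]; first by rewrite mulr0 scale0r addr0 mulr1.
by rewrite -exprS -scalerDl [in RHS]mulrS mulrDr mulr1.
Qed.

Lemma mderivm_linformX m c e :
  (linform c ^+ e)^`M[m] =
    (('X_[m]).@[c] * (e ^_ mdeg m)%:R) *: linform c ^+ (e - mdeg m).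
Proof.
elim/mnm_ind: m => [|i m IH].
  by rewrite mderivm0m mdeg0 ffactn0 mpolyX0 meval1 mul1r scale1r subn0.
rewrite mderivmDm mderivmU1m IH mderivZ mderiv_linformX scalerA mpolyXD mevalM.
rewrite mevalXU mdegD mdeg1 addn1 ffactnSr natrM subnS.
by rewrite mulrACA.
Qed.

(** An operator of order b acts on a power of a linear form through its value
    at that form, which turns conditions on derivatives of a sum of powers into
    conditions on values of polynomials. *)
Lemma diffop_linformX b c e D : D \is b.-homog ->
  diffop D (linform c ^+ e) = (D.@[c] * (e ^_ b)%:R) *: linform c ^+ (e - b).
Proof.
move=> /dhomogP Db; rewrite mevalE /diffop mulr_suml scaler_suml.
apply: eq_big_seq => m mD.
by rewrite mderivm_linformX Db // mevalX scalerA mulrA.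
Qed.

End LinearForms.

(** * Forms are combinations of powers of linear forms *)

Section PowersSpan.
Variables (k : fieldType) (n : nat).
Hypothesis char0 : [pchar k] =i pred0.

Lemma natr_inj_char0 : injective (fun i : nat => i%:R : k).
Proof.
have nat0 i : (i%:R == 0 :> k) = (i == 0%N) by move/pcharf0P: char0.
suff le i j : (i <= j)%N -> i%:R = j%:R :> k -> i = j.
  by move=> i j ij; case/orP: (leq_total i j) => [/le|/le h]; [exact|rewrite h].
move=> leij /eqP; rewrite eq_sym -subr_eq0 -natrB // nat0 subn_eq0 => leji.
by apply/eqP; rewrite eqn_leq leij.
Qed.

(** The weights are a column of the inverse of the Vandermonde matrix of the
    points 0, 1, ..., N - 1: the j-th coefficient of a polynomial of degree
    less than N is a fixed combination of its values at these points. *)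
Lemma coef_weights N (j : 'I_N) :
  exists w : 'I_N -> k, forall i : 'I_N,
    \sum_s w s * (s : nat)%:R ^+ i = (i == j)%:R.
Proof.
pose a : 'rV[k]_N := \row_s (s : nat)%:R.
have Vunit : Vandermonde N a \in unitmx.
  rewrite unitmxE det_Vandermonde unitfE; apply/prodf_neq0 => i _.
  apply/prodf_neq0 => l ltil; rewrite !mxE subr_eq0.
  by apply: contraTneq ltil => /natr_inj_char0 ->; rewrite ltnn.
exists (fun s => (invmx (Vandermonde N a) *m delta_mx j (0 : 'I_1)) s 0) => i.
have /matrixP/(_ i 0) := mulKVmx Vunit (delta_mx j (0 : 'I_1)).
rewrite mxE [RHS]mxE eqxx andbT => <-.
by apply: eq_bigr => s _; rewrite !mxE mulrC.
Qed.

(** Induction principle stating that the d-th powers span the forms of degree d.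
    Starting from l^d, trade the factors l for variables, one at a time: if
    all l^(e+1) m are in S, so are all values of the polynomial
    t |-> (l + t 'X_i)^(e+1) m, and hence so is its coefficient of t, which is
    (e+1) l^e 'X_i m. *)
Lemma homog_powers_ind (S : {mpoly k[n]} -> Prop) d :
    S 0 -> (forall c p q, S p -> S q -> S (c *: p + q)) ->
    (forall c, S (linform c ^+ d)) ->
  forall p, p \is d.-homog -> S p.
Proof.
move=> S0 SD SX.
have Ssum (I : Type) (r : seq I) (c : I -> k) (q : I -> {mpoly k[n]}) :
    (forall i, S (q i)) -> S (\sum_(i <- r) c i *: q i).
  move=> Sq; elim: r => [|i r IH]; first by rewrite big_nil.
  by rewrite big_cons; apply: SD.
suff SXm m : (mdeg m <= d)%N ->
    forall c, S (linform c ^+ (d - mdeg m) * 'X_[m]).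
  move=> p /dhomogP pd; rewrite [p]mpolyE big_seq.
  elim/big_ind: _ => // [q r Sq Sr|m mp].
    by rewrite -[q]scale1r; apply: SD.
  rewrite -[p@_m *: _]addr0; apply: SD => //.
  have /= md := pd _ mp; have := SXm m _ (fun=> 0).
  by rewrite md subnn mul1r; apply.
elim/mnm_ind: m => [_ c|i m IH].
  by rewrite mdeg0 subn0 mpolyX0 mulr1.
rewrite mdegD mdeg1 addn1 => ltmd c.
have [e de] : exists e, (d - mdeg m = e.+1)%N.
  by exists (d - (mdeg m).+1)%N; rewrite subnSK.
have {}IH c' : S (linform c' ^+ e.+1 * 'X_[m]).
  by rewrite -de; apply: IH (ltnW ltmd) _.
rewrite subnS de /=.
(* [lift ord0 ord0] is the index 1, of the coefficient of t. *)
have [w wE] := @coef_weights e.+2 (lift ord0 ord0).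
pose q (s : 'I_e.+2) : {mpoly k[n]} :=
  linform (fun j => c j + (s : nat)%:R * (j == i)%:R) ^+ e.+1 * 'X_[m].
suff -> : linform c ^+ e * 'X_[m + U_(i)] =
          (e.+1%:R : k)^-1 *: (\sum_s w s *: q s) + 0.
  by apply: SD => //; apply: Ssum => s; apply: IH.
have qE s : q s = \sum_(j < e.+2) ((s : nat)%:R ^+ j) *:
    ((linform c ^+ (e.+1 - j) * 'X_i ^+ j) *+ 'C(e.+1, j) * 'X_[m]).
  rewrite /q.
  have -> : linform (fun j => c j + (s : nat)%:R * (j == i)%:R) =
            linform c + (s : nat)%:R *: 'X_i.
    rewrite /linform (eq_bigr (fun j =>
      c j *: 'X_j + ((s : nat)%:R * (j == i)%:R) *: 'X_j)).
      rewrite big_split /=; congr (_ + _).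
      rewrite (bigD1 i) //= eqxx mulr1 big1 ?addr0 // => j /negPf ->.
      by rewrite mulr0 scale0r.
    by move=> j _; rewrite scalerDl.
  rewrite exprDn mulr_suml; apply: eq_bigr => j _.
  by rewrite exprZn -scalerAr scalerMnr -scalerAl.
rewrite addr0; under eq_bigr do rewrite qE scaler_sumr.
rewrite exchange_big /=.
under eq_bigr => j _.
  under eq_bigr do rewrite scalerA.
  rewrite -scaler_suml wE.
  over.
rewrite (bigD1 (lift ord0 ord0)) //= [X in _ + X]big1; last first.
  by move=> j /negPf ->; rewrite scale0r.
rewrite scale1r addr0 (_ : bump 0 0 = 1%N) // bin1 subn1 /= expr1.
rewrite -scaler_nat -scalerAl scalerA mulVf ?scale1r.
  by rewrite mpolyXD mulrA mulrAC.
by have /pcharf0P -> := char0.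
Qed.

End PowersSpan.

(** * Decompositions of W and the catalecticant *)

Section WaringDecompositions.
Variables (k : fieldType) (n d : nat).
Implicit Types (W : {vspace hform k n d}) (l : seq (hform k n 1)).

Lemma exists_waring_decomposition W : [pchar k] =i pred0 ->
  exists r (l : r.-tuple (hform k n 1)), (W <= <<map (hformX d) l>>)%VS.
Proof.
move=> char0.
suff [l Wl] : exists l, (W <= <<map (hformX d) l>>)%VS.
  by exists (size l), (in_tuple l).
suff h (X : seq (hform k n d)) : exists l, (<<X>> <= <<map (hformX d) l>>)%VS.
  by have [l] := h (vbasis W); rewrite (span_basis (vbasisP W)); exists l.
have mem1 (F : hform k n d) : exists l, F \in <<map (hformX d) l>>%VS.
  pose S p := exists l, exists2 G : hform k n d,
    G \in <<map (hformX d) l>>%VS & val G = p.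
  have : S (val F).
    apply: (homog_powers_ind char0 (S := S)) (dhomog_is_dhomog F) => [|c p q|c].
    - by exists [::], 0; rewrite ?mem0v.
    - move=> [l1 [G1 G1l <-]] [l2 [G2 G2l <-]].
      exists (l1 ++ l2), (c *: G1 + G2) => //.
      by rewrite map_cat span_cat memv_add // memvZ.
    - exists [:: DHomog (linform_homog c) : hform k n 1].
      exists (hformX d (DHomog (linform_homog c) : hform k n 1)) => //.
      by rewrite memv_span //= mem_seq1.
  by case=> l [G Gl /val_inj <-]; exists l.
elim: X => [|F X [l Xl]]; first by exists [::]; rewrite span_nil sub0v.
have [l' Fl'] := mem1 F; exists (l' ++ l).
by rewrite map_cat span_cat span_cons addvS // -memvE.
Qed.

(** All F in W are forms in the span of l, so conciseness leaves no room for
    that span to be smaller than V. *)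
Lemma concise_span W r (l : r.-tuple (hform k n 1)) :
  concise W -> (W <= <<map (hformX d) l>>)%VS -> (<<l>> = fullv)%VS.
Proof.
move=> cW Wl; apply: cW => F /(subvP Wl).
pose V' : {vspace hform k n 1} := <<l>>%VS.
pose X := map_tuple (hformX d) l => FX.
pose g i : {mpoly k[\dim V']} :=
  linform (fun j => coord (vbasis V') j (tnth l i)).
exists (\sum_i coord X i F *: g i ^+ d).
  apply: rpred_sum => i _; apply: rpredZ.
  have := dhomogMn d (linform_homog (fun j => coord (vbasis V') j (tnth l i))).
  by rewrite mul1n.
rewrite {1}(coord_span (X := X) FX) !raddf_sum /=; apply: eq_bigr => i _.
rewrite linearZ /= rmorphXn /=; congr (_ *: _).
rewrite (nth_map 0) ?size_tuple //=; congr (_ ^+ _).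
have il : tnth l i \in V' by rewrite memv_span // mem_tnth.
rewrite -tnth_nth {1}(coord_vbasis il) !raddf_sum /=; apply: eq_bigr => j _.
by rewrite linearZ /= comp_mpolyXU (nth_map 0) ?size_tuple.
Qed.

End WaringDecompositions.

Lemma diffop_sumr (k : fieldType) n (I : Type) (s : seq I) (c : I -> k)
    (D : {mpoly k[n]}) (F : I -> {mpoly k[n]}) :
  diffop D (\sum_(i <- s) c i *: F i) = \sum_(i <- s) c i *: diffop D (F i).
Proof.
elim: s => [|i s IH]; last by rewrite !big_cons diffop_linearr IH.
by rewrite !big_nil /diffop big1 // => m _; rewrite linear0 scaler0.
Qed.

(** In characteristic 0, G^`M[m] is a nonzero multiple of the coefficient of G
    at m when m has the degree of G. *)
Lemma homog_mderivm_eq0 (k : fieldType) n e (G : {mpoly k[n]}) :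
    [pchar k] =i pred0 -> G \is e.-homog ->
    (forall m, mdeg m = e -> G^`M[m] = 0) ->
  G = 0.
Proof.
move=> char0 Ga G0; apply/mpolyP => m; rewrite mcoeff0.
have [ma|ma] := eqVneq (mdeg m) e; last by rewrite (dhomog_nemf_coeff Ga).
have := mcoeff_mderivm m G 0%MM; rewrite (G0 _ ma) mcoeff0 addm0 => /esym/eqP.
rewrite -mulr_natr mulf_eq0 => /orP[/eqP //|].
have /pcharf0P -> := char0.
rewrite -leqn0 leqNgt => /negP[]; apply: prodn_gt0 => i.
by rewrite ffactnn fact_gt0.
Qed.

Section Catalecticant.
Variables (k : fieldType) (n d a : nat) (W : {vspace hform k n d}).
Variables (r : nat) (l : r.-tuple (hform k n 1)).
Hypotheses (char0 : [pchar k] =i pred0) (had : (a < d)%N).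
Hypothesis Wl : (W <= <<map (hformX d) l>>)%VS.
Let b := (d - a)%N.
Let X : r.-tuple (hform k n d) := map_tuple (hformX d) l.
Let coefs i : 'I_n -> k := fun j => (val (tnth l i))@_U_(j).

Lemma mem_powersE (F : hform k n d) : F \in W ->
  val F = \sum_i coord X i F *: linform (coefs i) ^+ d.
Proof.
move=> /(subvP Wl) FX; rewrite {1}(coord_span (X := X) FX) raddf_sum /=.
apply: eq_bigr => i _; rewrite (nth_map 0) ?size_tuple //= -tnth_nth.
by rewrite -hform1E.
Qed.

(** The image of w_i(F) l_i^d under an operator of order b whose value at
    l_i is 1. *)
Let power_term i (F : subvs_of W) : hform k n (d - b) :=
  (coord X i (vsval F) * (d ^_ b)%:R) *: hformX _ (tnth l i).

Let power_term_linear i : linear (power_term i).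
Proof.
move=> c F G; rewrite /power_term linearP /= mulrDl scalerDl.
by rewrite scalerA mulrA.
Qed.

HB.instance Definition _ i :=
  GRing.isLinear.Build _ _ _ _ (power_term i) (power_term_linear i).
Let power_hom i : 'Hom(subvs_of W, hform k n (d - b)) := linfun (power_term i).

Let power_comb (u : 'rV[k]_r) := \sum_i u 0 i *: power_hom i.

Let power_comb_linear : linear power_comb.
Proof.
move=> c u v; rewrite /power_comb scaler_sumr -big_split /=.
by apply: eq_bigr => i _; rewrite !mxE scalerDl scalerA.
Qed.

HB.instance Definition _ :=
  GRing.isLinear.Build _ _ _ _ power_comb power_comb_linear.
Let power_map := linfun power_comb.

(** C(D) is the image under [power_map] of the vector of the values D(l_i). *)
Lemma catalecticant_factor : (limg (catalecticant W b) <= limg power_map)%VS.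
Proof.
apply/subvP => _ /memv_imgP[D _ ->].
suff -> : catalecticant W b D = power_map (\row_i (val D).@[coefs i]).
  by rewrite memv_img // memvf.
apply/lfunP => F; rewrite catalecticantE lfunE /= /power_comb sum_lfunE.
apply: val_inj; rewrite /= (mem_powersE (subvsP F)) raddf_sum.
have -> : diffop (val D) (\sum_i coord X i (vsval F) *: linform (coefs i) ^+ d)
  = \sum_i coord X i (vsval F) *: diffop (val D) (linform (coefs i) ^+ d).
  exact: diffop_sumr.
apply: eq_bigr => i _; rewrite mxE scale_lfunE lfunE /= /power_term.
rewrite (diffop_linformX _ _ (dhomog_is_dhomog D)) !scalerA.
by rewrite -hform1E mulrCA.
Qed.

(** Up to nonzero factors, the derivative along m of
    \sum_i l_i(v)^b w_i(F) l_i^a is the value at v of the derivative of F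
    along m, for m of degree a. *)
Lemma Sigma_powers_mem v : Sigma W a v ->
  \row_i (val (tnth l i)).@[v] ^+ b \in lker power_map.
Proof.
move=> Sv; rewrite memv_ker lfunE; apply/eqP/lfunP => F.
have ba : (d - b = a)%N by rewrite subKn // ltnW.
rewrite zero_lfunE; apply: val_inj => /=.
apply: (homog_mderivm_eq0 char0 (dhomog_is_dhomog _)) => m mab.
have ma := etrans mab ba.
pose u i := (val (tnth l i)).@[v] ^+ b.
have -> : val (power_comb (\row_i u i) F) =
    \sum_i (u i * (coord X i (vsval F) * (d ^_ b)%:R)) *:
      linform (coefs i) ^+ a.
  rewrite /power_comb sum_lfunE raddf_sum; apply: eq_bigr => i _.
  by rewrite scale_lfunE lfunE mxE /= -hform1E ba scalerA.
have Xm : 'X_[k, m] \is (a).-homog by rewrite dhomogX /= ma.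
have := Sv (DHomog Xm) (vsval F) (subvsP F).
rewrite /= (mem_powersE (subvsP F)) diffop_sumr raddf_sum /=.
rewrite raddf_sum /=.
pose x i := coord X i (vsval F) * ('X_[k, m]).@[coefs i] * u i.
under eq_bigr do
  rewrite mevalZ (diffop_linformX _ _ Xm) mevalZ rmorphXn /= -hform1E.
rewrite (eq_bigr (fun i => (d ^_ a)%:R * x i)) => [|i _]; last first.
  rewrite /x -/b -/(u i); ring.
rewrite -mulr_sumr => /eqP; rewrite mulf_eq0.
have /pcharf0P -> := char0; rewrite -leqn0 leqNgt ffact_gt0 ltnW //= => /eqP x0.
rewrite (eq_bigr (fun i => ((d ^_ b)%:R * (a ^_ a)%:R * x i) *: 1)) => [|i _].
  by rewrite -scaler_suml -mulr_sumr x0 mulr0 scale0r.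
rewrite mderivmZ mderivm_linformX ma subnn expr0 scalerA; congr (_ *: _).
rewrite /x; ring.
Qed.

(** Here c is the dimension of the kernel of [power_map], E a basis of this
    kernel, and y_j(v) the coordinates in E of the point (l_i(v)^b)_i. *)
Lemma Sigma_powers_span : exists c,
  (c + \dim (limg (catalecticant W b)) <= r)%N /\
  exists (y : 'I_c -> ('I_n -> k) -> k) (E : 'I_c -> 'I_r -> k),
    forall v i, Sigma W a v ->
      (val (tnth l i)).@[v] ^+ b = \sum_j E j i * y j v.
Proof.
pose u v : 'rV[k]_r := \row_i (val (tnth l i)).@[v] ^+ b.
exists (\dim (lker power_map)); split.
  have := limg_ker_dim power_map fullv.
  rewrite capfv dimvf /dim /= mul1n => dimE.
  by rewrite -[X in (_ <= X)%N]dimE leq_add2l dimvS // catalecticant_factor.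
exists (fun j v => coord (vbasis (lker power_map)) j (u v)).
exists (fun j i => (vbasis (lker power_map))`_j 0 i) => v i Sv.
have := congr1 (fun w : 'rV[k]_r => w 0 i) (coord_vbasis (Sigma_powers_mem Sv)).
rewrite mxE => ->; rewrite summxE; apply: eq_bigr => j _.
by rewrite mxE mulrC.
Qed.
End Catalecticant.

(** A polynomial in s of degree e cannot be bounded by one of degree c < e; the
    witness s = e! K (q + 1)^c is where the leading terms cross. *)
Lemma binomial_growth e c K q :
  (forall s, 'C(s + e, e) <= K * (q * s).+1 ^ c)%N -> (e <= c)%N.
Proof.
move=> growth; rewrite leqNgt; apply/negP => ltce.
pose s := (e`! * K * q.+1 ^ c)%N.
have lower : (s.+1 ^ e <= e`! * 'C(s + e, e))%N.
  rewrite mulnC bin_ffact ffact_prod -[X in (_ ^ X)%N]card_ord -prod_nat_const.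
  apply: leq_prod => i _; rewrite -addnBA; last exact/ltnW/ltn_ord.
  by rewrite -addn1 leq_add2l subn_gt0.
have upper : ((q * s).+1 ^ c <= q.+1 ^ c * s.+1 ^ c)%N.
  rewrite -expnMn; case: (c) => // c'; rewrite leq_exp2r //.
  by rewrite mulSn addSn ltnS mulnS addnA leq_addl.
have : (s.+1 ^ c.+1 <= s * s.+1 ^ c)%N.
  apply: leq_trans (leq_pexp2l (ltn0Sn s) ltce) _; apply: leq_trans lower _.
  have -> : (s * s.+1 ^ c = e`! * (K * (q.+1 ^ c * s.+1 ^ c)))%N.
    by rewrite !mulnA.
  rewrite leq_mul2l; apply/orP; right.
  by apply: leq_trans (growth s) _; rewrite leq_mul2l upper orbT.
by rewrite expnS leq_pmul2r ?expn_gt0 // ltnn.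
Qed.

(** * Spanning and independent families of functions on a set *)

Section FunctionsOnSets.
Variables (k : fieldType) (n : nat).
Local Notation pt := ('I_n -> k).
Local Open Scope classical_set_scope.
Implicit Types (X Z : set pt) (p q f : {mpoly k[n]}).

Definition spanned_on X (I : finType) (g : I -> pt -> k) (h : pt -> k) :=
  exists a : I -> k, forall v, X v -> h v = \sum_i a i * g i v.

Definition indep_on Z N (p : 'I_N -> {mpoly k[n]}) :=
  forall a : 'I_N -> k, (forall v, Z v -> \sum_i a i * (p i).@[v] = 0) ->
    forall i, a i = 0.

(** The matrix of coefficients on the spanning family has independent rows. *)
Lemma indep_on_card X Z (I : finType) (g : I -> pt -> k) N
    (p : 'I_N -> {mpoly k[n]}) :
  Z `<=` X -> (forall i, spanned_on X g (fun v => (p i).@[v])) ->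
  indep_on Z p -> (N <= #|I|)%N.
Proof.
move=> ZX /choice[a aE] pindep.
pose A := \matrix_(i < N, j < #|I|) a i (enum_val j).
suff /eqP <- : row_free A by exact: rank_leq_col.
apply: inj_row_free => u uA0; apply/rowP => i; rewrite mxE.
apply: (pindep (fun i => u 0 i)) => v Zv.
rewrite (eq_bigr (fun i' => \sum_s u 0 i' * (a i' s * g s v))); last first.
  by move=> i' _; rewrite aE ?mulr_sumr //; apply: ZX.
rewrite exchange_big (reindex _ (onW_bij _ (@enum_val_bij I))) /=.
rewrite big1 // => j _.
have /rowP/(_ j) := uA0; rewrite !mxE => uAj.
under eq_bigr do rewrite mulrA.
rewrite -mulr_suml (_ : \sum_i _ = 0) ?mul0r // -[RHS]uAj.
by apply: eq_bigr => i' _; rewrite mxE.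
Qed.

Lemma spanned_on_lin X (I : finType) (g : I -> pt -> k) (J : finType)
    (a : J -> k) (h : J -> pt -> k) (h' : pt -> k) :
  (forall j, spanned_on X g (h j)) ->
  (forall v, X v -> h' v = \sum_j a j * h j v) -> spanned_on X g h'.
Proof.
move=> /choice[e eE] h'E; exists (fun i => \sum_j a j * e j i) => v Xv.
rewrite h'E //.
rewrite (eq_bigr (fun j => \sum_i a j * (e j i * g i v))); last first.
  by move=> j _; rewrite eE ?mulr_sumr.
rewrite exchange_big; apply: eq_bigr => i _.
by rewrite mulr_suml; apply: eq_bigr => j _; rewrite mulrA.
Qed.

End FunctionsOnSets.

(** * Upper bound for the functions of bounded degree *)

Section IntegralSpan.
Variables (k : fieldType) (n r c b : nat) (X : set ('I_n -> k)).
Variables (lf : 'I_r -> ('I_n -> k) -> k) (y : 'I_c -> ('I_n -> k) -> k).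
Variables (E : 'I_c -> 'I_r -> k).
Hypothesis b_gt0 : (0 < b)%N.
Hypothesis integral_lf : forall v i, X v ->
  lf i v ^+ b = \sum_j E j i * y j v.
Hypothesis coord_lf : forall x : 'I_n, exists a : 'I_r -> k,
  forall v, v x = \sum_i a i * lf i v.

Definition mixed_monomial t
    (q : {ffun 'I_r -> 'I_b} * {ffun 'I_c -> 'I_t.+1}) (v : 'I_n -> k) : k :=
  \prod_i lf i v ^+ q.1 i * \prod_j y j v ^+ q.2 j.

Local Notation spanned t := (spanned_on X (@mixed_monomial t)).

Lemma spanned_monomial t (rho : 'I_r -> nat) (mu : 'I_c -> nat)
    (h : ('I_n -> k) -> k) :
  (forall i, rho i < b)%N -> (forall j, mu j <= t)%N ->
  (forall v, X v -> h v = \prod_i lf i v ^+ rho i * \prod_j y j v ^+ mu j) ->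
  spanned t h.
Proof.
move=> rho_lt mu_le hE.
pose q0 := ([ffun i => Ordinal (rho_lt i)], [ffun j => inord (mu j)])
  : {ffun 'I_r -> 'I_b} * {ffun 'I_c -> 'I_t.+1}.
exists (fun q => (q == q0)%:R) => v Xv.
rewrite (bigD1 q0) //= eqxx mul1r big1 ?addr0; last first.
  by move=> q /negPf ->; apply: mul0r.
rewrite hE // /mixed_monomial; congr (_ * _); apply: eq_bigr => i _.
  by rewrite ffunE.
by rewrite ffunE inordK // ltnS.
Qed.

(** Multiplication by l_i raises rho_i, unless rho_i = b - 1; then l_i^b
    appears, and is replaced by a combination of the y_j, which raises one of
    the mu_j instead. *)
Lemma spanned_mul_lf t i h :
  spanned t h -> spanned t.+1 (fun v => lf i v * h v).
Proof.
case=> a aE.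
apply: (spanned_on_lin (a := a)
  (h := fun q v => lf i v * mixed_monomial q v)) => [[rho mu]|v Xv]; last first.
  by rewrite aE // mulr_sumr; apply: eq_bigr => q _; rewrite mulrCA.
have [ltb|geb] := ltnP (rho i).+1 b.
  apply: (@spanned_monomial _ (fun i' => (rho i' + (i' == i))%N)
      (fun j => mu j)) => [i'|j|v Xv].
  - by case: eqP => [->|_]; rewrite ?addn1 ?addn0.
  - exact/ltnW/ltn_ord.
  rewrite /mixed_monomial /= mulrA; congr (_ * _).
  rewrite (bigD1 i) //= [RHS](bigD1 i) //= eqxx addn1 exprS mulrA.
  congr (_ * _).
  by apply: eq_bigr => i' /negPf ->; rewrite addn0.
apply: (spanned_on_lin (a := fun j => E j i) (h := fun j v =>
    \prod_(i' | i' != i) lf i' v ^+ rho i' *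
    (y j v * \prod_j' y j' v ^+ mu j'))) => [j|v Xv].
  apply: (@spanned_monomial _ (fun i' => if i' == i then 0%N else rho i')
      (fun j' => (mu j' + (j' == j))%N)) => [i'|j'|v Xv].
  - by case: eqP.
  - case: eqP => _; first by rewrite addn1 ltn_ord.
    by rewrite addn0; exact/ltnW/ltn_ord.
  congr (_ * _).
    rewrite [RHS](bigD1 i) //= eqxx expr0 mul1r.
    by apply: eq_bigr => i' /negPf ->.
  rewrite (bigD1 j) //= [RHS](bigD1 j) //= eqxx addn1 exprS mulrA.
  congr (_ * _).
  by apply: eq_bigr => j' /negPf ->; rewrite addn0.
have rhoE : (rho i).+1 = b by apply/eqP; rewrite eqn_leq ltn_ord.
rewrite /mixed_monomial (bigD1 i) //= mulrA mulrA -exprS rhoE integral_lf //.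
rewrite mulrAC -!mulrA mulr_suml; apply: eq_bigr => j _.
by rewrite -!mulrA; congr (_ * _); ring.
Qed.

Lemma spannedS t h : spanned t h -> spanned t.+1 h.
Proof.
case=> a aE; apply: (spanned_on_lin (a := a)
  (h := fun q v => mixed_monomial q v)) => [[rho mu]|v Xv]; last exact: aE.
apply: (@spanned_monomial _ (fun i => rho i) (fun j => mu j)) => // j.
exact/ltnW/ltn_ord.
Qed.

Lemma spanned_mpoly t (p : {mpoly k[n]}) :
  (msize p <= t.+1)%N -> spanned t (fun v => p.@[v]).
Proof.
move=> pt.
have Xm m : spanned (mdeg m) (fun v => ('X_[m]).@[v]).
  elim/mnm_ind: m => [|x m IH].
    apply: (@spanned_monomial _ (fun=> 0%N) (fun=> 0%N)) => // v Xv.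
    by rewrite mpolyX0 meval1 !big1 ?mulr1.
  rewrite mdegD mdeg1 addn1; have [a aE] := coord_lf x.
  apply: (spanned_on_lin (a := a)
    (h := fun i v => lf i v * ('X_[m]).@[v])) => [i|v Xv].
    exact: spanned_mul_lf.
  rewrite mpolyXD mevalM mevalXU aE mulrC mulr_suml.
  by apply: eq_bigr => i _; rewrite mulrA.
have Xt m t' : (mdeg m <= t')%N -> spanned t' (fun v => ('X_[m]).@[v]).
  move=> /subnK <-; elim: (t' - mdeg m)%N => [|j IH]; first exact: Xm.
  by rewrite addSn; apply: spannedS.
apply: (spanned_on_lin (a := fun m : 'X_{1..n < t.+1} => p@_m)
   (h := fun m v => ('X_[m]).@[v])) => [m|v Xv].
  by apply: Xt; rewrite -ltnS bmdeg.
rewrite {1}(mpolywE pt) raddf_sum /=; apply: eq_bigr => m _.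
by rewrite mevalZ.
Qed.

End IntegralSpan.

(** * Lower bound along a chain of irreducible closed sets *)

Section Chains.
Variables (k : fieldType) (n : nat).
Local Notation pt := ('I_n -> k).
Local Open Scope classical_set_scope.
Implicit Types (X Z A : set pt) (p q f : {mpoly k[n]}).

Lemma closed_separation Z A :
  zariski_closed Z -> Z `<` A ->
  exists f, (forall v, Z v -> f.@[v] = 0) /\ exists2 v, A v & f.@[v] != 0.
Proof.
move=> [S ->] [_ /existsNP[v /not_implyP[Av /existsNP[f /not_implyP[Sf fv]]]]].
by exists f; split=> [w|]; [exact|exists v => //; exact/eqP].
Qed.

Lemma irreducible_mul_eq0 Z f p : irreducible_closed Z ->
  (exists2 v, Z v & f.@[v] != 0) ->
  (forall v, Z v -> (f * p).@[v] = 0) -> forall v, Z v -> p.@[v] = 0.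
Proof.
have clos q : zariski_closed [set v | q.@[v] = 0].
  exists [set q]; apply/seteqP; split=> v /=; first by move=> qv _ ->.
  by move=> /(_ q erefl).
move=> [_ _ irr] [w Zw fw] fp0 v Zv.
case: (irr _ _ (clos f) (clos p)) => [u Zu|Zf|]; last exact.
  have /eqP := fp0 _ Zu; rewrite mevalM mulf_eq0.
  by case/orP => /eqP; [left|right].
by have /= /eqP := Zf _ Zw; rewrite (negPf fw).
Qed.

(** Pascal's rule, by induction on the chain: let f vanish on Z_i but not on
    Z_(i+1).  A family independent on Z_i, followed by f times a family
    independent on Z_(i+1), is independent on Z_(i+1): restricting a relation
    to Z_i kills the first half of its coefficients, and then f cancels since
    Z_(i+1) is irreducible. *)
Lemma chain_indep e (Z : nat -> set pt) :
  (forall i, (i <= e)%N -> irreducible_closed (Z i)) ->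
  (forall i, (i < e)%N -> Z i `<` Z i.+1) ->
  exists w : nat, forall s, exists N (p : 'I_N -> {mpoly k[n]}),
    [/\ ('C(s + e, e) <= N)%N, forall j, (msize (p j) <= (w * s).+1)%N
      & indep_on (Z e) p].
Proof.
move=> Zirr Zlt.
have /choice[f fP] (i : 'I_e) : exists f,
    (forall v, Z i v -> f.@[v] = 0) /\ exists2 v, Z i.+1 v & f.@[v] != 0.
  apply: closed_separation; last exact: Zlt.
  by case: (Zirr i (ltnW (ltn_ord i))).
(* The successor absorbs the slack in [msizeM_le]. *)
pose w := (\max_(i < e) msize (f i)).+1; exists w.
have one i s : (i <= e)%N -> exists (N : nat) (p : 'I_N -> {mpoly k[n]}),
    [/\ (1 <= N)%N, forall j, (msize (p j) <= (w * s).+1)%N & indep_on (Z i) p].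
  move=> ie; exists 1%N, (fun=> 1); split=> // [j|a a0 j].
    by rewrite msize1.
  have [_ [v Zv] _] := Zirr _ ie.
  by have := a0 v Zv; rewrite big_ord1 meval1 mulr1 (ord1 j).
suff main i s : (i <= e)%N -> exists N (p : 'I_N -> {mpoly k[n]}),
    [/\ ('C(s + i, i) <= N)%N, forall j, (msize (p j) <= (w * s).+1)%N
      & indep_on (Z i) p] by move=> s; apply: main.
elim: i s => [|i IHi] s ie; first by rewrite bin0; apply: one.
elim: s => [|s [N2 [p2 [CN2 sz2 ind2]]]]; first by rewrite binn; apply: one.
have [N1 [p1 [CN1 sz1 ind1]]] := IHi s.+1 (ltnW ie).
have [fZ fZS] := fP (Ordinal ie).
set g := f _ in fZ fZS.
have gq : (msize g < w)%N by exact: (leq_bigmax (Ordinal ie)).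
exists (N1 + N2)%N,
  (fun j => match split j with inl j1 => p1 j1 | inr j2 => g * p2 j2 end).
split=> [|j|a a0].
- rewrite addSn binS addnC; apply: leq_add => //.
  by rewrite addnS -addSn.
- case: split => j'; first exact: sz1.
  apply: leq_trans (msizeM_le _ _) _.
  by rewrite mulnS -addSn -addnS; apply: leq_add.
have a0' v : Z i.+1 v -> \sum_j a (lshift N2 j) * (p1 j).@[v] +
    g.@[v] * (\sum_j a (rshift N1 j) * (p2 j).@[v]) = 0.
  move=> Zv; rewrite -[RHS](a0 v Zv) big_split_ord /=; congr (_ + _).
    by apply: eq_bigr => j _; rewrite (unsplitK (inl j)).
  rewrite mulr_sumr; apply: eq_bigr => j _.
  by rewrite (unsplitK (inr j)) mevalM mulrCA.
have a1 j : a (lshift N2 j) = 0.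
  apply: (ind1 (fun j => a (lshift N2 j))) => v Zv.
  have [+ _] := Zlt i ie => /(_ v Zv) /a0'.
  by rewrite (fZ _ Zv) mul0r addr0.
have a2 j : a (rshift N1 j) = 0.
  apply: (ind2 (fun j => a (rshift N1 j))) => v Zv.
  have pE u : (\sum_j a (rshift N1 j) *: p2 j).@[u] =
              \sum_j a (rshift N1 j) * (p2 j).@[u].
    by rewrite raddf_sum; apply: eq_bigr => j' _; rewrite /= mevalZ.
  rewrite -pE; apply: (irreducible_mul_eq0 (Zirr _ ie) fZS) Zv => u Zu.
  rewrite mevalM pE; have := a0' u Zu; rewrite big1 ?add0r // => j' _.
  by rewrite a1 mul0r.
by move=> j; rewrite -(splitK j); case: split.
Qed.

End Chains.

(** * The bound *)

Lemma supremum_nat_le (A : set nat) c : (forall e, A e -> (e <= c)%N) ->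
  (supremum 0%N A <= c)%N.
Proof.
move=> Ac; rewrite /supremum; case: ifP => // _.
by case: xgetP => // y _ [_ least]; rewrite -leEnat; apply: least => e /Ac.
Qed.

(** Nonemptiness matters: the infimum of the empty set is the default 0. *)
Lemma infimum_nat_ge (A : set nat) c : (exists x, A x) ->
  (forall x, A x -> (c <= x)%N) -> (c <= infimum 0%N A)%N.
Proof.
move=> [x Ax] cA; rewrite /infimum ifF; last first.
  by apply/eqP => A0; rewrite A0 in Ax.
have exA : exists x, `[< A x >] by exists x; apply/asboolP.
have [m /asboolP Am min_m] := ex_minnP exA.
case: xgetP => [y _ [_ greatest]|/(_ m)[]].
  by rewrite -leEnat; apply: greatest => z /cA.
split=> [z Az|z]; last exact.
by rewrite leEnat; apply: min_m; apply/asboolP.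
Qed.

Section Bound.
Variables (k : fieldType) (n d a : nat) (W : {vspace hform k n d}).
Hypotheses (char0 : [pchar k] =i pred0) (had : (a < d)%N) (hW : concise W).

(** The two counts are compared on the top of a chain in Sigma: its independent
    family lies in the span of the products l^rho y^mu, where the b^r choices
    of rho only affect the constant of the growth. *)
Lemma waring_length_ge r (l : r.-tuple (hform k n 1)) :
  (W <= <<map (hformX d) l>>)%VS ->
  (\dim (limg (catalecticant W (d - a))) + zariski_dim (Sigma W a) <= r)%N.
Proof.
move=> Wl.
have [c [cr [y [E yE]]]] := Sigma_powers_span char0 had Wl.
apply: leq_trans cr; rewrite addnC leq_add2r.
apply: supremum_nat_le => e [Z [Zirr Zlt ZX]].
have [w wP] := chain_indep Zirr Zlt.
have coord_l (x : 'I_n) : exists b : 'I_r -> k,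
    forall v, v x = \sum_i b i * (val (tnth l i)).@[v].
  have Xx : 'X_[k, U_(x)] \is 1.-homog by rewrite dhomogX /= mdeg1.
  pose h : hform k n 1 := DHomog Xx.
  have hl : h \in <<l>>%VS by rewrite (concise_span hW Wl) memvf.
  exists (fun i => coord l i h) => v.
  have /(congr1 (fun h => (val h).@[v])) := coord_span hl.
  rewrite /= mevalXU => ->; rewrite !raddf_sum /=.
  by apply: eq_bigr => i _; rewrite mevalZ -tnth_nth.
have b_gt0 : (0 < d - a)%N by rewrite subn_gt0.
apply: (@binomial_growth _ _ ((d - a) ^ r) w) => s.
have [N [p [CN szp indp]]] := wP s.
apply: leq_trans CN _.
have := indep_on_card ZX (fun j => spanned_mpoly b_gt0
  (fun v i => @yE v i) coord_l (szp j)) indp.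
by rewrite card_prod !card_ffun !card_ord.
Qed.

End Bound.

Theorem theorem3p13 (k : closedFieldType) (hchar : [pchar k]%R =i pred0)
    (n d a : nat) (had : (a < d)%N) (W : {vspace hform k n d})
    (hW : concise W) :
  (\dim (limg (catalecticant W (d - a))) + zariski_dim (Sigma W a)
     <= waring_rank W)%N.
Proof.
apply: infimum_nat_ge; first exact: exists_waring_decomposition.
by move=> r [l]; apply: waring_length_ge.
Qed.
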